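(* Let $1\le k\le s$ be integers, let $\alpha\in(0,1)$, and let $0\le \alpha_1\le\alpha_2\le\cdots\le\alpha_s$ be constants with $\alpha_s>0$. For integers $n$ with $k\le n\le s$ define $$S_1(k,s,n)= n\,\frac{\alpha_{s-n+k}}{k}+n\sum_{k<j\le n}\frac{\alpha_{s-n+j}-\alpha_{s-n+j-1}}{j},\qquad D_1(k,s)=\max_{k\le n\le s}S_1(k,s,n).$$ Consider testing null hypotheses $H_i: P\in\omega_i$, $i=1,\dots,s$, using $p$-values $\hat p_1,\dots,\hat p_s$ that satisfy $P\{\hat p_i\le u\}\le u$ for all $u\in(0,1)$ and all $P\in\omega_i$ (with no assumption on their joint dependence), and consider the stepup procedure with critical values $\alpha_i'=\alpha\alpha_i/D_1(k,s)$, $i=1,\dots,s$. (i) This procedure satisfies $k\text{-}FWER\le\alpha$ for every $P$. (ii) Moreover, if $D'>0$ is a constant such that the stepup procedure with critical values $\tilde\alpha_i=\alpha\alpha_i/D'$, $i=1,\dots,s$, satisfies $k\text{-}FWER\le\alpha$ for every set $I\subseteq\{1,\dots,s\}$ of true null hypotheses and every joint distribution of $(\hat p_1,\dots,\hat p_s)$ on $[0,1]^s$ with $P\{\hat p_i\le u\}\le u$ for all $u\in(0,1)$ and $i\in I$, then $\alpha_i'\ge\tilde\alpha_i$ for every $i=1,\dots,s$.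
   Context: Setting: data are generated from some $P\in\Omega$; the hypothesis $H_i$ is the statement $P\in\omega_i$ with $\omega_i\subseteq\Omega$. The set of true null hypotheses is $I=I(P)=\{i: P\in\omega_i\}$. The $p$-values $\hat p_1,\dots,\hat p_s$ are $[0,1]$-valued random variables (functions of the data). Nothing is assumed about the $p$-values of false hypotheses or about the dependence among the $p$-values. Stepup procedure with nondecreasing critical values $c_1\le\cdots\le c_s$: order the $p$-values as $\hat p_{(1)}\le\cdots\le\hat p_{(s)}$ with corresponding hypotheses $H_{(1)},\dots,H_{(s)}$. If $\hat p_{(s)}\le c_s$, reject all hypotheses; otherwise reject $H_{(1)},\dots,H_{(r)}$, where $r$ is the smallest index with $\hat p_{(s)}>c_s,\dots,\hat p_{(r+1)}>c_{r+1}$; if $\hat p_{(r)}>c_r$ for all $r$, reject nothing. (Equivalently, reject $H_{(1)},\dots,H_{(r)}$ with $r=\max\{i:\hat p_{(i)}\le c_i\}$, and nothing if no such $i$ exists.) $k\text{-}FWER = P\{\text{at least } k \text{ hypotheses } H_i \text{ with } i\in I(P) \text{ are rejected}\}$. *)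

(* Defs.v *)
From HB Require Import structures.
From mathcomp Require Import all_boot all_order all_algebra.
From mathcomp Require Import all_classical all_reals all_analysis.

Set Implicit Arguments.
Unset Strict Implicit.
Unset Printing Implicit Defensive.

Import Order.TTheory GRing.Theory Num.Theory.
Import numFieldNormedType.Exports.

Local Open Scope classical_set_scope.
Local Open Scope ring_scope.

(* The hypotheses H_1, ..., H_s are indexed by 'I_s (so H_i is the ordinal i-1).
   Sequences of constants and of order statistics are functions on nat
   with 1-based indices: only the values at 1, ..., s matter. *)

Section Stepup.
Variables (R : realType) (s : nat).
Implicit Types (x : 'I_s -> R) (c : nat -> R).

(* H_(1), ..., H_(s); ties are broken by the index of the hypothesis. *)
Definition ordered_hyps x : seq 'I_s :=
  sort (fun i j => x i <= x j) (enum 'I_s).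

(* p_(r), for 1 <= r <= s. *)
Definition order_stat x (r : nat) : R :=
  nth 0 [seq x i | i <- ordered_hyps x] r.-1.

(* The largest r in 1..s with p_(r) <= c_r, or 0 if there is none. *)
Definition stepup_index c x : nat :=
  \max_(1 <= r < s.+1 | order_stat x r <= c r) r.

Definition stepup_rejected c x : {set 'I_s} :=
  finset (mem (take (stepup_index c x) (ordered_hyps x))).

Definition stepup_kFWER d (T : measurableType d) (P : probability T R)
    (p : 'I_s -> T -> R) c (k : nat) (I : {set 'I_s}) : \bar R :=
  P [set t | (k <= #|I :&: stepup_rejected c (fun i => p i t)|)%N].

End Stepup.

Definition superuniform (R : realType) d (T : measurableType d)
    (P : probability T R) (q : T -> R) : Prop :=
  forall u : R, 0 < u < 1 -> (P [set t | (q t <= u)%R] <= u%:E)%E.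

Definition true_nulls (R : realType) d (T : measurableType d) (s : nat)
    (omega : 'I_s -> set (probability T R)) (P : probability T R) : {set 'I_s} :=
  finset (fun i => `[< omega i P >]).

Definition S1 (R : realType) (a : nat -> R) (k s n : nat) : R :=
  n%:R * (a (s - n + k)%N / k%:R)
  + n%:R * \sum_(k.+1 <= j < n.+1) (a (s - n + j)%N - a (s - n + j).-1) / j%:R.

(* The seed of the maximum is the term n = k, which is in the range if k <= s. *)
Definition D1 (R : realType) (a : nat -> R) (k s : nat) : R :=
  \big[Num.max/S1 a k s k]_(k <= n < s.+1) S1 a k s n.

(* Main.v *)
Require Import Defs.
From HB Require Import structures.
From mathcomp Require Import all_boot all_order all_algebra.
From mathcomp Require Import all_classical all_reals all_analysis.
From mathcomp Require Import measurable_realfun ring.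

(** Write n for the number of true hypotheses and b_j = c_(s-n+j).

    Control.  If the stepup procedure rejects j >= k true hypotheses, it
    rejects at most s - n + j hypotheses in all, so at least j true p-values
    lie below b_j ([stepup_true_count]).  Give the indicator of
    {true p-value i <= b_l} the weight 1/(l(l+1)) for l < n and 1/n for l = n.
    The weights from j on telescope to 1/j, hence j true p-values below b_j
    contribute at least 1 in total ([tail_weight_cover]): the weighted sum of
    the indicators dominates the indicator of the bad event.  Taking
    expectations ([weighted_union_bound]) bounds k-FWER by the weighted sum of
    the n b_l, under any dependence, and summation by parts ([S1E]) identifies
    this bound as S_1(k,s,n) times the scaling factor of the critical values.
    Dividing by the maximum D_1 of the S_1(k,s,n) makes it at most alpha.

    Optimality.  The bound is attained ([worst_case]).  Let the false p-values
    be 0.  For each level j in k..n choose, with probability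
    (b_j - b_(j-1))/j, b_(k-1) being read as 0, each of the n cyclic windows of j true hypotheses; the p-values in the chosen
    window are all b_j and the other true ones are 1.  Every true hypothesis
    lies in exactly j of the n windows of size j, so its p-value equals b_j
    with probability b_j - b_(j-1) and is superuniform, being rounded up from
    a uniform variable.  Every window leads to at least k true rejections, so
    k-FWER is the total mass of the windows, which is the bound above.  If
    S_1(k,s,n) > D' for some n, this mass exceeds alpha for the critical values
    alpha a_i / D', once the b_j are scaled down if needed to keep the mass at
    most 1; hence D_1 <= D'. *)

Set Implicit Arguments.
Unset Strict Implicit.
Unset Printing Implicit Defensive.

Import Order.TTheory GRing.Theory Num.Theory.
Import numFieldNormedType.Exports.

Local Open Scope classical_set_scope.
Local Open Scope ring_scope.

Local Notation nondecreasing_on m n c :=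
  {in [pred i | m <= i <= n]%N &, {homo c : i j / (i <= j)%N >-> i <= j}}.

Lemma rank_offset_bounds (k n s j : nat) :
  (0 < k)%N -> (n <= s)%N -> (k <= j <= n)%N -> (1 <= s - n + j <= s)%N.
Proof.
move=> k_gt0 ns /andP[kj jn].
rewrite (leq_trans k_gt0) ?(leq_trans kj) ?leq_addl//=.
by rewrite -[leqRHS](subnK ns) leq_add2l.
Qed.

(** * The rejected set of a stepup procedure *)

Section Combinatorics.
Variables (R : realType) (s : nat).
Implicit Types (x : 'I_s -> R) (c : nat -> R) (u : R).

Lemma perm_ordered_hyps x : perm_eq (ordered_hyps x) (enum 'I_s).
Proof. by rewrite /ordered_hyps; exact/permPl/perm_sort. Qed.

Lemma sorted_ordered_hyps x : sorted <=%R (map x (ordered_hyps x)).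
Proof. by rewrite sorted_map; apply: sort_sorted => i j; exact: le_total. Qed.

Lemma count_ordered_hyps x (b : pred 'I_s) :
  count b (ordered_hyps x) = #|[set i | b i]%SET|.
Proof.
by rewrite (permP (perm_ordered_hyps x)) cardsE cardE enumT -size_filter.
Qed.

(** Trades order statistics for counts, so that sorting and ties can be forgotten. *)
Lemma order_stat_le x u r : (1 <= r <= s)%N ->
  (order_stat x r <= u) = (r <= #|[set i | (x i <= u)%R]%SET|)%N.
Proof.
case: r => // r /= rs; rewrite /order_stat /=.
have sz : size (map x (ordered_hyps x)) = s.
  by rewrite size_map (perm_size (perm_ordered_hyps x)) -cardE card_ord.
have srt := sorted_ordered_hyps x.
rewrite -(count_ordered_hyps x) -(count_map x (fun y => y <= u)).
apply/idP/idP => [le_u|]; last exact: nth_count_le.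
rewrite ltnNge; apply/negP => ler.
have := nth_count_gt 0 srt (x := u) (i := r).
by rewrite ler sz rs ltNge le_u => /(_ isT).
Qed.

Lemma take_ordered_hyps x u :
  take #|[set i | (x i <= u)%R]%SET| (ordered_hyps x)
  = [seq i <- ordered_hyps x | x i <= u].
Proof.
rewrite -(count_ordered_hyps x); have := sorted_ordered_hyps x.
elim: (ordered_hyps x) => //= i l IHl.
rewrite (path_sortedE le_trans) => /andP[le_i sl].
case: ifPn => [_|iu]; first by rewrite /= IHl.
rewrite -[RHS]IHl// (_ : count _ l = 0)%N ?take0//.
apply/eqP; rewrite -leqn0 leqNgt -has_count; apply/hasPn => j jl.
apply: contra iu; apply: le_trans.
by move/allP: le_i; apply; exact: map_f.
Qed.

Lemma stepup_index_ge c x r : (1 <= r <= s)%N ->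
  (r <= #|[set i | (x i <= c r)%R]%SET|)%N -> (r <= stepup_index c x)%N.
Proof.
move=> rs; rewrite -order_stat_le// => xr.
rewrite /stepup_index; apply: (@leq_bigmax_seq _ _ _ id) => //.
by rewrite mem_index_iota ltnS.
Qed.

Lemma stepup_index_spec c x : (0 < stepup_index c x)%N ->
  (stepup_index c x <= s)%N /\
  (stepup_index c x <= #|[set i | (x i <= c (stepup_index c x))%R]%SET|)%N.
Proof.
pose K r := (0 < r)%N -> (r <= s)%N /\ (r <= #|[set i | (x i <= c r)%R]%SET|)%N.
change (K (stepup_index c x)); rewrite /stepup_index big_seq_cond.
elim/big_ind: _ => [//|r1 r2 K1 K2|r]; first by rewrite /maxn; case: ifP.
rewrite mem_index_iota ltnS => /andP[rs le_c] _.
by split; [case/andP: rs|rewrite -order_stat_le].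
Qed.

Lemma stepup_index_gt0 c x i :
  i \in stepup_rejected c x -> (0 < stepup_index c x)%N.
Proof. by rewrite inE; case: stepup_index => //; rewrite take0. Qed.

(** Ties cannot straddle the rejection boundary: more than [r] values below
    [c r], hence below [c r.+1], would contradict the maximality of the stepup
    index [r]. *)
Lemma stepup_rejectedE c x :
  nondecreasing_on 1 s c ->
  (0 < stepup_index c x)%N ->
  stepup_rejected c x = [set i | x i <= c (stepup_index c x)]%SET
  /\ #|stepup_rejected c x| = stepup_index c x.
Proof.
move=> c_mono r_gt0; have [rs r_le] := stepup_index_spec r_gt0.
set r := stepup_index c x in r_gt0 rs r_le *.
have rE : #|[set i | x i <= c r]%SET| = r.
  apply/eqP; rewrite eqn_leq r_le andbT leqNgt; apply/negP => r_lt.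
  have r1s : (r.+1 <= s)%N.
    by apply: leq_trans r_lt _; rewrite -[leqRHS]card_ord max_card.
  suff : (r.+1 <= r)%N by rewrite ltnn.
  apply: stepup_index_ge => //; apply: leq_trans r_lt _.
  apply/subset_leq_card/fintype.subsetP => i; rewrite !inE => /le_trans; apply.
  by apply: c_mono; rewrite ?inE ?r_gt0 ?rs.
have rejE : stepup_rejected c x = [set i | x i <= c r]%SET.
  apply/setP => i; rewrite /stepup_rejected -/r -{1}rE take_ordered_hyps !inE.
  by rewrite mem_filter (perm_mem (perm_ordered_hyps x)) mem_enum andbT.
by rewrite rejE.
Qed.

Lemma sub_stepup_rejected c x r :
  nondecreasing_on 1 s c ->
  (1 <= r <= s)%N -> (r <= #|[set i | (x i <= c r)%R]%SET|)%N ->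
  [set i | x i <= c r]%SET \subset stepup_rejected c x.
Proof.
move=> c_mono rs xr; have le_r := stepup_index_ge rs xr.
case/andP: (rs) => r0 _; have [] := stepup_rejectedE c_mono (leq_trans r0 le_r).
move=> -> _; apply/fintype.subsetP => i; rewrite !inE => /le_trans; apply.
apply: c_mono => //; rewrite inE (leq_trans r0 le_r)/=.
by have [] := stepup_index_spec (leq_trans r0 le_r).
Qed.

(** Describes rejection by finitely many comparisons of p-values with constants,
    from which its measurability follows. *)
Lemma mem_stepup_rejected c x i :
  nondecreasing_on 1 s c ->
  (i \in stepup_rejected c x) =
  [exists r : 'I_s, (x i <= c r.+1) && (r < #|[set j | (x j <= c r.+1)%R]%SET|)%N].
Proof.
move=> c_mono; apply/idP/existsP => [i_rej|[r /andP[xi xr]]]; last first.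
  by apply: (fintype.subsetP (sub_stepup_rejected c_mono _ xr)); rewrite ?inE/=.
have r0 := stepup_index_gt0 i_rej.
have [rs le_r] := stepup_index_spec r0; have [rejE _] := stepup_rejectedE c_mono r0.
move: i_rej; rewrite rejE inE => xi.
have lt_r : ((stepup_index c x).-1 < s)%N by rewrite prednK.
by exists (Ordinal lt_r); rewrite /= prednK// xi.
Qed.

(** The witness is the number [j] of true rejections: at most [s - #|I|] of the
    rejected hypotheses are false, so the stepup index is at most
    [s - #|I| + j] and the rejected p-values lie below that critical value. *)
Lemma stepup_true_count c x (I : {set 'I_s}) k :
  nondecreasing_on 1 s c ->
  (0 < k <= #|I :&: stepup_rejected c x|)%N ->
  exists2 j, (k <= j <= #|I|)%N
    & (j <= #|[set i in I | (x i <= c (s - #|I| + j)%N)%R]|)%N.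
Proof.
move=> c_mono /andP[k0 k_le]; exists #|I :&: stepup_rejected c x|.
  by rewrite k_le subset_leq_card// subsetIl.
have r0 : (0 < stepup_index c x)%N.
  have /card_gt0P[i] := leq_trans k0 k_le.
  by rewrite finset.in_setI => /andP[_]; exact: stepup_index_gt0.
have [rs _] := stepup_index_spec r0.
have [rejE cardr] := stepup_rejectedE c_mono r0.
apply/subset_leq_card/fintype.subsetP => i.
rewrite finset.in_setI [in X in _ && X]rejE => /andP[iI].
rewrite !inE iI /= => /le_trans; apply.
have Is : (#|I| <= s)%N by rewrite -[leqRHS]card_ord max_card.
have le_j : (#|I :&: stepup_rejected c x| <= #|I|)%N.
  by rewrite subset_leq_card// subsetIl.
apply: c_mono; rewrite ?inE ?r0//.
  by rewrite (rank_offset_bounds k0)// k_le.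
rewrite -{1}cardr -(cardsID I (stepup_rejected c x)) finset.setIC addnC leq_add2r.
rewrite -[X in (X - _)%N]card_ord -(cardsC I) addKn subset_leq_card//.
by apply/fintype.subsetP => j; rewrite !inE => /andP[].
Qed.

End Combinatorics.

(** * Telescoping weights *)

Section Weights.
Variable (R : realType).
Implicit Types (b : nat -> R).

(** The weights whose sum from [j] to [n] is [1/j]; written as [1/(j(j+1))]
    rather than [1/j - 1/(j+1)] so that they are nonnegative at [j = 0] too. *)
Definition tail_weight (n j : nat) : R :=
  if (j < n)%N then (j * j.+1)%:R^-1 else j%:R^-1.

Lemma tail_weight_ge0 n j : 0 <= tail_weight n j.
Proof. by rewrite /tail_weight; case: ifP. Qed.

(** Summation by parts. *)
Lemma sum_tail_weight b k n : (0 < k <= n)%N ->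
  \sum_(k <= j < n.+1) tail_weight n j * b j =
  b k / k%:R + \sum_(k.+1 <= j < n.+1) (b j - b j.-1) / j%:R.
Proof.
move=> /andP[k0]; elim: n => [|n IHn].
  by rewrite leqn0 => /eqP kE; rewrite kE in k0.
rewrite leq_eqVlt => /predU1P[->|].
  by rewrite big_nat1 big_geq// addr0 /tail_weight ltnn mulrC.
rewrite ltnS => kn; rewrite [in RHS]big_nat_recr//= addrA -IHn//.
rewrite big_nat_recr/=; last exact: leqW.
rewrite !(big_nat_recr n)//=.
rewrite (eq_big_nat _ _ (F2 := fun j => tail_weight n j * b j)); last first.
  by move=> j /andP[_ jn]; rewrite /tail_weight (leqW jn) jn.
rewrite -!addrA; congr (_ + _); rewrite /tail_weight !ltnn ltnSn natrM.
have n0 : n%:R != 0 :> R by rewrite pnatr_eq0 -lt0n (leq_trans k0).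
by field; rewrite n0 nat1r pnatr_eq0.
Qed.

Lemma sum_tail_weight1 k n : (0 < k <= n)%N ->
  \sum_(k <= j < n.+1) tail_weight n j = k%:R^-1.
Proof.
move=> kn; have := sum_tail_weight (fun=> 1) kn.
under eq_bigr do rewrite mulr1.
by move=> ->; rewrite big1 ?addr0 ?div1r// => j _; rewrite subrr mul0r.
Qed.

(** Each of the [j] values below [b j] is below every later [b l], and so
    collects the whole tail of weights from [j] on, which is [1/j]. *)
Lemma tail_weight_cover (s : nat) (x : 'I_s -> R) (I : {set 'I_s}) b k n j :
  nondecreasing_on k n b ->
  (0 < k)%N -> (k <= j <= n)%N -> (j <= #|[set i in I | (x i <= b j)%R]|)%N ->
  1 <= \sum_(i in I) \sum_(k <= l < n.+1) tail_weight n l * (x i <= b l)%R%:R.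
Proof.
move=> b_mono k0 /andP[kj jn] le_j.
have j0 := leq_trans k0 kj.
have ge0 i l : 0 <= tail_weight n l * (x i <= b l)%R%:R :> R.
  by rewrite mulr_ge0// tail_weight_ge0.
apply: (@le_trans _ _ (\sum_(i in [set i in I | (x i <= b j)%R]) j%:R^-1)).
  by rewrite sumr_const -[leRHS]mulr_natl ler_pdivlMr ?ltr0n// mul1r ler_nat.
rewrite (eq_bigl (fun i => (i \in I) && (x i <= b j))); last first.
  by move=> i; rewrite inE.
rewrite big_mkcondr /=; apply: ler_sum => i iI.
case: ifPn => [xi|_]; last by apply: sumr_ge0 => l _; exact: ge0.
rewrite (big_cat_nat kj) ?leqW//= ler_wpDl ?sumr_ge0// -(@sum_tail_weight1 j n) ?j0//.
apply: ler_sum_nat => l /andP[jl ln].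
rewrite (le_trans xi) ?mulr1// b_mono ?inE ?kj ?jn//.
by rewrite (leq_trans kj jl) -ltnS.
Qed.

End Weights.

(** * Control of the k-FWER *)

Section WeightedUnionBound.
Context d (T : measurableType d) (R : realType) (P : {measure set T -> \bar R}).

(** Markov's inequality for a weighted sum of indicators; with unit weights it is
    the union bound. *)
Lemma weighted_union_bound (J : eqType) (r : seq J) (w : J -> R) (B : J -> set T)
    (E : set T) :
  (forall j, 0 <= w j) -> (forall j, measurable (B j)) -> measurable E ->
  (forall t, E t -> 1 <= \sum_(j <- r) w j * \1_(B j) t) ->
  (P E <= \sum_(j <- r) (w j)%:E * P (B j))%E.
Proof.
move=> w0 mB mE cover.
have mI j : measurable_fun [set: T] (EFin \o \1_(B j) : T -> \bar R).
  exact/measurable_EFinP/measurable_indic.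
have mwI j : measurable_fun [set: T] (fun t => (w j)%:E * (\1_(B j) t)%:E)%E.
  exact: (measurable_funeM _ (mI j)).
have -> : (\sum_(j <- r) (w j)%:E * P (B j)
    = \int[P]_t \sum_(j <- r) (w j)%:E * (\1_(B j) t)%:E)%E.
  rewrite ge0_integral_sum//; last first.
    by move=> j t _; rewrite -EFinM lee_fin mulr_ge0.
  apply: eq_bigr => j _; rewrite ge0_integralZl_EFin//.
    by rewrite integral_indic// setIT.
  exact: mI.
have -> : P E = (\int[P]_t (\1_E t)%:E)%E by rewrite integral_indic// setIT.
apply: ge0_le_integral => //.
- exact/measurable_EFinP/measurable_indic.
- exact: emeasurable_sum.
move=> t _; under eq_bigr do rewrite -EFinM; rewrite sumEFin lee_fin.
rewrite [leLHS]indicE; have [/set_mem Et|_] := boolP (t \in E); first exact: cover.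
by apply: sumr_ge0 => j _; rewrite mulr_ge0.
Qed.
End WeightedUnionBound.

Section Control.
Context d (T : measurableType d) (R : realType).

(** Only finitely many patterns of membership in the [B j] occur, and each is a
    finite intersection of the [B j] and their complements. *)
Lemma measurable_finite_test (J : finType) (B : J -> set T)
    (phi : {ffun J -> bool} -> bool) :
  (forall j, measurable (B j)) -> measurable [set t | phi [ffun j => t \in B j]].
Proof.
move=> mB.
rewrite (_ : mkset _ = \bigcup_(f in [set f | phi f])
    \bigcap_(j in [set: J]) (if f j then B j else ~` B j)).
  apply: fin_bigcup_measurable => // f _.
  apply: fin_bigcap_measurable => // j _.
  by case: ifP => _ //; exact: measurableC.
apply/seteqP; split => [t phit|t [f phif Bf]] /=.
  exists [ffun j => t \in B j] => // j _; rewrite ffunE.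
  by case: ifPn => [/set_mem//|/negP tB /mem_set].
rewrite (_ : [ffun j => _] = f)//; apply/ffunP => j; rewrite ffunE.
by have := Bf j I; case: (f j) => [/mem_set->|tB]//; apply/negP => /set_mem.
Qed.

Lemma measurable_sublevel (q : {mfun T >-> R}) u : measurable [set t | (q t <= u)%R].
Proof.
by rewrite -[X in measurable X]setTI -(preimage_itvNyc q u); exact: measurable_funP.
Qed.

(** Extends superuniformity to the level 0, by letting the level decrease to 0:
    critical values may vanish. *)
Lemma superuniform_le (P : probability T R) (q : {mfun T >-> R}) u :
  superuniform P q -> 0 <= u < 1 -> (P [set t | (q t <= u)%R] <= u%:E)%E.
Proof.
move=> qP /andP[]; rewrite le_eqVlt => /predU1P[<- _|u0 u1]; last first.
  by apply: qP; rewrite u0.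
apply/lee_addgt0Pr => e e0; rewrite add0e.
have m01 : 0 < Num.min e 2^-1 < 1.
  by rewrite lt_min e0 invr_gt0 ltr0n/= gt_min invf_lt1 ?ltr1n ?orbT.
apply: (@le_trans _ _ (Num.min e 2^-1)%:E); last by rewrite lee_fin ge_min lexx.
apply: le_trans (qP _ m01); apply: le_measure; rewrite ?inE.
- exact: measurable_sublevel.
- exact: measurable_sublevel.
by move=> t /= /le_trans; apply; case/andP: m01 => /ltW.
Qed.

Lemma measurable_stepup_event (s : nat) (p : 'I_s -> {mfun T >-> R})
    (c : nat -> R) (k : nat) (I : {set 'I_s}) :
  nondecreasing_on 1 s c ->
  measurable [set t | (k <= #|I :&: stepup_rejected c (fun i => p i t)|)%N].
Proof.
move=> c_mono.
pose B (ir : 'I_s * 'I_s) := [set t | (p ir.1 t <= c ir.2.+1)%R].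
pose rej (f : {ffun 'I_s * 'I_s -> bool}) :=
  [set i | [exists r, f (i, r) && (r < #|[set j | f (j, r)]%SET|)%N]]%SET.
have mB ir : measurable (B ir) by exact: measurable_sublevel.
have := measurable_finite_test (fun f => k <= #|I :&: rej f|)%N mB.
congr measurable.
apply/funext => t /=; congr (is_true (k <= _)%N).
congr #|mem (_ :&: _)|; apply/setP => i.
rewrite mem_stepup_rejected// inE; apply: eq_existsb => r.
rewrite !ffunE /B /= mem_setE; congr (_ && (_ < _)%N).
by apply: eq_card => j; rewrite !inE ffunE mem_setE.
Qed.

(** The pathwise covering turns into this bound on taking expectations, where the
    dependence between the p-values drops out by linearity. For [#|I| < k] the
    sum is empty, and [k] true rejections are impossible. *)
Lemma stepup_kFWER_le (P : probability T R) (s : nat) (p : 'I_s -> {mfun T >-> R})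
    (c : nat -> R) (k : nat) (I : {set 'I_s}) :
  nondecreasing_on 1 s c ->
  (forall j, (1 <= j <= s)%N -> 0 <= c j < 1) -> (0 < k)%N ->
  (forall i, i \in I -> superuniform P (p i)) ->
  (stepup_kFWER P p c k I <= (#|I|%:R *
     \sum_(k <= j < #|I|.+1) tail_weight R #|I| j * c (s - #|I| + j)%N)%R%:E)%E.
Proof.
move=> c_mono c01 k0 pP; set n := #|I|.
have ns : (n <= s)%N by rewrite -[leqRHS]card_ord max_card.
pose b l := c (s - n + l)%N.
have bs l := @rank_offset_bounds k n s l k0 ns.
have b_mono : nondecreasing_on k n b.
  by move=> i j /bs ? /bs ? ij; rewrite c_mono ?inE// leq_add2l.
pose B (il : 'I_s * nat) := [set t | (p il.1 t <= b il.2)%R].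
pose w (il : 'I_s * nat) := tail_weight R n il.2.
pose r := [seq (i, l) | i <- enum I, l <- index_iota k n.+1].
apply: (@le_trans _ _ (\sum_(il <- r) (w il)%:E * P (B il))%E).
  apply: weighted_union_bound => [il|il||t].
  - exact: tail_weight_ge0.
  - exact: measurable_sublevel.
  - exact: measurable_stepup_event.
  move=> /= k_le; rewrite big_allpairs big_enum /=.
  have kI : (0 < k <= #|I :&: stepup_rejected c (fun i => p i t)|)%N by rewrite k0.
  have [j kj le_j] := stepup_true_count c_mono kI.
  apply: (le_trans (tail_weight_cover b_mono k0 kj le_j)).
  apply: ler_sum => i _; apply: ler_sum => l _; rewrite /w /= indicE.
  by rewrite /B mem_setE.
rewrite big_allpairs big_enum /= mulr_natl -sumr_const -sumEFin.
apply: lee_sum => i iI; rewrite -sumEFin big_nat [leRHS]big_nat.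
apply: lee_sum => l /andP[kl ln]; rewrite EFinM lee_wpmul2l//.
  by rewrite lee_fin tail_weight_ge0.
by apply: superuniform_le; [exact: pP|apply/c01/bs; rewrite kl -ltnS].
Qed.

End Control.

(** Identifies the constant of the bound by summation by parts. *)
Lemma S1E (R : realType) (a : nat -> R) (k s n : nat) : (0 < k <= n)%N ->
  S1 a k s n = n%:R * \sum_(k <= j < n.+1) tail_weight R n j * a (s - n + j)%N.
Proof.
move=> kn; rewrite sum_tail_weight// /S1 -mulrDr; congr (_ * (_ + _)).
rewrite big_nat [RHS]big_nat; apply: eq_bigr => j /andP[kj _].
by rewrite -!subn1 addnBA//; apply: leq_trans kj.
Qed.

Lemma S1_le_D1 (R : realType) (a : nat -> R) (k s n : nat) : (k <= n <= s)%N ->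
  S1 a k s n <= D1 a k s.
Proof.
by move=> kn; apply: le_bigmax_seq => //; rewrite mem_index_iota ltnS.
Qed.

Lemma S1_diag (R : realType) (a : nat -> R) (k s : nat) : (0 < k <= s)%N ->
  S1 a k s k = a s.
Proof.
move=> /andP[k0 ks]; rewrite /S1 subnK// big_geq// mulr0 addr0 mulrC divfK//.
by rewrite pnatr_eq0 -lt0n.
Qed.

(** * Finitely supported probabilities *)

Section DiscreteProbability.
Context d (T : measurableType d) (R : realType).

(** As Dirac masses are given by indicators, the formula holds for every set [A],
    measurable or not. *)
Lemma exists_discrete_measure (J : eqType) (r : seq J) (w : J -> R) (x : J -> T) :
  {in r, forall j, 0 <= w j} ->
  exists mu : {measure set T -> \bar R},
    forall A, mu A = (\sum_(j <- r) w j * \1_A (x j))%:E.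
Proof.
elim: r => [_|j r IHr w0]; first by exists mzero => A; rewrite big_nil.
have [|mu muE] := IHr; first by move=> i ir; apply: w0; rewrite inE ir orbT.
have wj0 : 0 <= w j by apply: w0; rewrite mem_head.
exists (measure_add (mscale (NngNum wj0) (dirac (x j))) mu) => A.
by apply: (etrans (measure_addE _ _ A)); rewrite muE big_cons EFinD EFinM.
Qed.

Lemma exists_discrete_probability (J : eqType) (r : seq J) (w : J -> R) (x : J -> T) :
  {in r, forall j, 0 <= w j} -> \sum_(j <- r) w j = 1 ->
  exists Q : probability T R,
    forall A, Q A = (\sum_(j <- r) w j * \1_A (x j))%:E.
Proof.
move=> w0 w1; have [mu muE] := exists_discrete_measure x w0.
have muT : mu [set: T] = 1%E.
  by rewrite muE; under eq_bigr do rewrite indicT mulr1; rewrite w1.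
case: r w0 w1 muE => [|j r] _ w1 muE.
  by move: w1; rewrite big_nil => /eqP; rewrite eq_sym oner_eq0.
(* Normalizing by the total mass 1 changes nothing, but yields a probability. *)
exists (mnormalize mu (dirac (x j))) => A.
by rewrite -muE /= /mnormalize muT onee_eq0 /= invr1 mule1.
Qed.

End DiscreteProbability.

(** * Increments of a nondecreasing sequence *)

Section Increments.
Variables (R : realType) (b : nat -> R) (k n : nat).
Hypothesis b_mono :
  nondecreasing_on k n b.

(** The jump of [b] at [j], for [b] taken to be 0 before the index [k]. *)
Definition increment (j : nat) : R := if j == k then b k else b j - b j.-1.

Lemma increment_ge0 j : 0 <= b k -> (k <= j <= n)%N -> 0 <= increment j.
Proof.
move=> b0 /andP[kj jn]; rewrite /increment; case: eqVneq => // jk.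
have {jk kj} : (k < j)%N by rewrite ltn_neqAle eq_sym jk.
case: j jn => // j jn kj; rewrite subr_ge0 b_mono ?leqnSn// inE.
  by rewrite -ltnS kj ltnW.
by rewrite ltnW.
Qed.

Lemma sum_increment m : (k <= m)%N -> \sum_(k <= j < m.+1) increment j = b m.
Proof.
move=> km; rewrite big_ltn ?ltnS// {1}/increment eqxx -[RHS](subrKC (b k)).
congr (_ + _); rewrite -telescope_sumr// big_add1 /=.
by apply: eq_big_nat => j /andP[kj _]; rewrite /increment gtn_eqF.
Qed.

(** A variable equal to [b j] with probability [increment j] is superuniform:
    the increments up to the last [b j] below [u] add up to that [b j]. *)
Lemma sum_increment_le u m : 0 <= b k -> 0 <= u -> (k <= m <= n)%N ->
  \sum_(k <= j < m.+1 | b j <= u) increment j <= u.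
Proof.
move=> b0 u0 /andP[]; elim: m => [|m IHm] km mn.
  move: km; rewrite leqn0 => /eqP kE; rewrite -kE big_mkcond big_nat1.
  by rewrite /increment eqxx; case: ifP.
have [bu|ub] := leP (b m.+1) u.
  apply: le_trans bu; rewrite -[leRHS]sum_increment//.
  rewrite big_mkcond; apply: ler_sum_nat => j /andP[kj jm].
  by case: ifP => // _; rewrite increment_ge0// kj (leq_trans _ mn).
move: km; rewrite leq_eqVlt => /predU1P[kE|km].
  by rewrite -kE big_mkcond big_nat1 kE (lt_geF ub).
rewrite big_mkcond big_nat_recr/=; last exact: leqW.
by rewrite (lt_geF ub) addr0 -big_mkcond IHm// ltnW.
Qed.

End Increments.

(** * The worst case *)

Lemma card_ord_lt (n j : nat) : (j <= n)%N -> #|[set l : 'I_n | (l < j)%N]%SET| = j.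
Proof.
move=> jn; rewrite -sum1dep_card -(big_ord_widen n (fun=> 1%N) jn).
by rewrite sum1_card card_ord.
Qed.

(** By symmetry in [i] and [m] this counts both the windows [m] of size [j] which
    contain a given [i] and the elements of a given window. *)
Lemma card_window (n i j : nat) : (j <= n)%N ->
  #|[set m : 'I_n | ((i + m) %% n < j)%N]%SET| = j.
Proof.
case: n => [|n] jn.
  move: jn; rewrite leqn0 => /eqP->.
  by apply/eqP; rewrite -leqn0 -[leqRHS](card_ord 0) max_card.
pose f (m : 'I_n.+1) : 'I_n.+1 := inord ((i + m) %% n.+1).
have f_inj : injective f.
  move=> m m' /(congr1 val); rewrite /= !inordK ?ltn_mod// => /eqP.
  by rewrite eqn_modDl !modn_small// => /eqP/val_inj.
rewrite -[RHS](card_ord_lt jn) -[RHS](card_preimset _ f_inj).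
by apply: eq_card => m; rewrite !inE inordK ?ltn_mod.
Qed.

Section Sharpness.
Variables (R : realType) (s k n : nat) (b c : nat -> R).
Hypotheses (k_gt0 : (0 < k)%N) (kn : (k <= n)%N) (ns : (n <= s)%N).
Hypothesis b_mono :
  nondecreasing_on k n b.
Hypothesis b_ge0 : 0 <= b k.
Hypothesis c_mono :
  nondecreasing_on 1 s c.
Hypothesis b_le_c : forall j, (k <= j <= n)%N -> b j <= c (s - n + j)%N.

Let I : {set 'I_s} := [set i : 'I_s | (i < n)%N]%SET.

Let window (j m : nat) : {set 'I_s} := [set i : 'I_s in I | ((i + m) %% n < j)%N].

(** The atoms of the least favourable distribution: [Some (j, m)] is the [m]-th
    cyclic window of size [j], and [None] makes all true p-values equal to 1. *)
Definition window_point (jm : option (nat * nat)) : s.-tuple R :=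
  mktuple (fun i : 'I_s => if (i < n)%N
    then if jm is Some (j, m) then if ((i + m) %% n < j)%N then b j else 1 else 1
    else 0).

Let card_widen (A : pred nat) :
  #|[set i : 'I_s | (i < n)%N && A i]%SET| = #|[set i : 'I_n | A i]%SET|.
Proof.
have w_inj : injective (widen_ord ns).
  by move=> i j /(congr1 val) /= /val_inj.
rewrite -(card_imset _ w_inj); apply: eq_card => i; rewrite inE.
apply/andP/imsetP => [[i_n Ai]|[l lA ->]]; last first.
  by rewrite inE in lA; rewrite /= ltn_ord.
by exists (Ordinal i_n); rewrite ?inE//; apply: val_inj.
Qed.

Let card_trueI : #|I| = n.
Proof.
rewrite -[RHS]card_ord -cardsT -[RHS](card_widen predT).
by apply: eq_card => i; rewrite !inE andbT.
Qed.

Let card_windowI j m : (j <= n)%N -> #|window j m| = j.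
Proof.
move=> jn; rewrite -[RHS](card_window m jn).
under [in RHS]eq_finset do rewrite addnC.
rewrite -(card_widen (fun i => (i + m) %% n < j)%N).
by apply: eq_card => i; rewrite !inE.
Qed.

(** The zero p-values of the [s - n] false hypotheses and the [j] p-values of the
    window make [s - n + j] values below the critical value of that rank, so all
    of them are rejected. *)
Lemma window_point_rejects j m : (k <= j <= n)%N ->
  (k <= #|I :&: stepup_rejected c (tnth (window_point (Some (j, m))))|)%N.
Proof.
move=> kjn; have /andP[kj jn] := kjn; set x := tnth _.
have b0 : 0 <= b j by apply: le_trans b_ge0 _; rewrite b_mono ?inE ?leqnn ?kn ?kjn.
have rs := rank_offset_bounds k_gt0 ns kjn.
have xW i : i \in window j m -> x i <= c (s - n + j)%N.
  by rewrite !inE => /andP[i_n ij]; rewrite /x tnth_mktuple i_n ij b_le_c.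
have r_le : (s - n + j <= #|[set i | (x i <= c (s - n + j)%N)%R]%SET|)%N.
  rewrite -{1}card_trueI -{1}[s]card_ord -(cardsC I) addKn.
  rewrite -{1}(card_windowI m jn) -cardsUI [X in (_ + X)%N](_ : _ = 0)%N ?addn0.
    apply/subset_leq_card/fintype.subsetP => i; rewrite finset.in_setU inE.
    rewrite [in X in _ -> X]inE.
    move=> /orP[|/xW//]; rewrite inE => /negPf i_n.
    by rewrite /x tnth_mktuple i_n (le_trans b0)// b_le_c.
  by apply: eq_card0 => i; rewrite !inE; case: (i < n)%N.
rewrite (leq_trans kj)// -[leqLHS](card_windowI m jn).
apply/subset_leq_card/fintype.subsetP => i iW; rewrite finset.in_setI.
apply/andP; split; first by move: iW; rewrite !inE => /andP[].
by apply: (fintype.subsetP (sub_stepup_rejected c_mono rs r_le)); rewrite inE xW.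
Qed.

Let mass := n%:R * \sum_(k <= j < n.+1) tail_weight R n j * b j.

Let atoms := None :: [seq Some (j, m) | j <- index_iota k n.+1, m <- index_iota 0 n].

Let weight (jm : option (nat * nat)) : R :=
  if jm is Some (j, _) then increment b k j / j%:R else 1 - mass.

Let massE : \sum_(k <= j < n.+1) \sum_(0 <= m < n) increment b k j / j%:R = mass.
Proof.
under eq_bigr do rewrite sumr_const_nat subn0 -[_ *+ n]mulr_natl.
rewrite -mulr_sumr /mass sum_tail_weight ?k_gt0//; congr (_ * _).
rewrite big_ltn ?ltnS// {1}/increment eqxx; congr (_ + _).
by apply: eq_big_nat => j /andP[kj _]; rewrite /increment gtn_eqF.
Qed.

(** Makes the bound of [stepup_kFWER_le] sharp as long as it does not exceed 1.
    The thresholds [b] may be smaller than the critical values, which lets a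
    bound above 1 be scaled down first. *)
Lemma worst_case : mass <= 1 ->
  exists (J : {set 'I_s}) (Q : probability (s.-tuple R) R),
    [/\ Q [set x | forall i, 0 <= tnth x i <= 1] = 1%E,
        forall i, i \in J -> superuniform Q (fun x => tnth x i) &
        (mass%:E <= stepup_kFWER Q (fun i x => tnth x i) c k J)%E].
Proof.
move=> mass1.
have b0 j : (k <= j <= n)%N -> 0 <= b j.
  move=> kj; apply: le_trans b_ge0 _.
  by rewrite b_mono ?inE ?leqnn ?kn//; case/andP: kj.
have n0 : (0 < n)%N by exact: leq_trans kn.
(* The last term of the sum in [mass] is [b n / n]. *)
have b1 j : (k <= j <= n)%N -> b j <= 1.
  move=> kj; apply: (@le_trans _ _ (b n)).
    by rewrite b_mono ?inE ?leqnn ?kn//; case/andP: kj.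
  apply: le_trans mass1; rewrite /mass big_nat_recr//= mulrDr.
  rewrite /tail_weight ltnn mulrA divff ?pnatr_eq0 -?lt0n// mul1r lerDr.
  rewrite mulr_ge0// big_nat sumr_ge0// => j' /andP[kj' j'n].
  by rewrite mulr_ge0 ?tail_weight_ge0// b0// kj' ltnW.
have weight_ge0 : {in atoms, forall jm, 0 <= weight jm}.
  move=> jm; rewrite inE => /predU1P[->|]; first by rewrite /= subr_ge0.
  case/allpairsP => -[j m] /= [+ _ ->]; rewrite mem_index_iota ltnS => kj /=.
  by rewrite divr_ge0// (increment_ge0 b_mono).
have sum_atoms F : \sum_(jm <- atoms) weight jm * F jm = (1 - mass) * F None
    + \sum_(k <= j < n.+1) \sum_(0 <= m < n) increment b k j / j%:R * F (Some (j, m)).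
  by rewrite big_cons big_allpairs_dep.
have weight1 : \sum_(jm <- atoms) weight jm = 1.
  under eq_bigr do rewrite -[weight _]mulr1.
  rewrite (sum_atoms (fun=> 1)) mulr1.
  under eq_bigr do under eq_bigr do rewrite mulr1.
  by rewrite massE subrK.
have [Q QE] := exists_discrete_probability window_point weight_ge0 weight1.
exists I, Q; split.
- rewrite QE big_seq (eq_bigr weight) -?big_seq ?weight1// => jm jm_in.
  rewrite indicE mem_set ?mulr1// => i; rewrite tnth_mktuple.
  case: ifP => _; last by rewrite lexx ler01.
  case: jm jm_in => [[j m]|_]; last by rewrite lexx ler01.
  rewrite inE /= => /allpairsP[[j' m'] /= [+ _ [-> ->]]].
  rewrite mem_index_iota ltnS => kj.
  by case: ifP => _; rewrite ?lexx ?ler01// b0// b1.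
- move=> i; rewrite inE => i_n u /andP[u0 u1].
  rewrite QE lee_fin sum_atoms indicE memNset ?mulr0 ?add0r; last first.
    by rewrite /= tnth_mktuple i_n leNgt u1.
  have kn_n : (k <= n <= n)%N by rewrite kn leqnn.
  apply: le_trans (sum_increment_le b_mono b_ge0 (ltW u0) kn_n).
  rewrite [leRHS]big_mkcond; apply: ler_sum_nat => j /andP[kj jn].
  have j0 : j%:R != 0 :> R by rewrite pnatr_eq0 -lt0n (leq_trans k_gt0).
  rewrite -mulr_sumr.
  rewrite (eq_bigr (fun m =>
    if ((i + m) %% n < j)%N then ((b j <= u)%R : nat)%:R else 0)); last first.
    move=> m _.
    have -> : \1_[set x : s.-tuple R | tnth x i <= u] (window_point (Some (j, m)))
        = (tnth (window_point (Some (j, m))) i <= u)%R%:R :> R by rewrite indicE mem_setE.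
    rewrite tnth_mktuple i_n.
    by case: ifP => // _; rewrite leNgt u1.
  rewrite -big_mkcond big_mkord sumr_const.
  rewrite (_ : #|_| = j); last first.
    by rewrite -[RHS](card_window i (n := n)) ?cardsE// -ltnS.
  by case: ifP => _; rewrite ?mul0rn ?mulr0// divfK.
rewrite /stepup_kFWER QE lee_fin sum_atoms.
rewrite ler_wpDl ?mulr_ge0 ?subr_ge0// -massE.
apply: ler_sum_nat => j; rewrite ltnS => kj; apply: ler_sum => m _.
by rewrite indicE mem_set ?mulr1//; exact: window_point_rejects.
Qed.

End Sharpness.

(** * Control and optimality *)

Theorem theorem3p1 (R : realType) (k s : nat) (alpha : R) (a : nat -> R)
  (hks : (1 <= k <= s)%N)
  (halpha : 0 < alpha < 1)
  (ha_ge0 : 0 <= a 1%N)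
  (ha_mono : forall i j : nat, (1 <= i)%N -> (i <= j)%N -> (j <= s)%N -> a i <= a j)
  (ha_gt0 : 0 < a s) :
  (forall (d : measure_display) (T : measurableType d)
          (Omega : set (probability T R))
          (omega : 'I_s -> set (probability T R))
          (p : 'I_s -> {mfun T >-> R}),
      (forall i, omega i `<=` Omega) ->
      (forall i t, 0 <= p i t <= 1) ->
      (forall i P, omega i P -> superuniform P (p i)) ->
      forall P, Omega P ->
        (stepup_kFWER P p (fun i => alpha * a i / D1 a k s)%R k (true_nulls omega P)
           <= alpha%:E)%E)
  /\
  (forall D' : R, 0 < D' ->
      (forall (I : {set 'I_s}) (Q : probability (s.-tuple R) R),
          Q [set x | forall i, 0 <= tnth x i <= 1] = 1%E ->
          (forall i, i \in I -> superuniform Q (fun x => tnth x i)) ->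
          (stepup_kFWER Q (fun i x => tnth x i) (fun i => alpha * a i / D')%R k I
             <= alpha%:E)%E) ->
      forall i : nat, (1 <= i <= s)%N -> alpha * a i / D' <= alpha * a i / D1 a k s).
Proof.
have /andP[k_gt0 ks] := hks; have /andP[alpha_gt0 alpha_lt1] := halpha.
have D1_ge : a s <= D1 a k s by rewrite -{1}(S1_diag a hks) S1_le_D1// leqnn.
have D1_gt0 : 0 < D1 a k s by exact: lt_le_trans D1_ge.
have a_ge0 i : (1 <= i <= s)%N -> 0 <= a i.
  by move=> /andP[i1 is_]; rewrite (le_trans ha_ge0)// ha_mono.
have c_mono D : 0 < D -> nondecreasing_on 1 s (fun i => alpha * a i / D).
  move=> D0 i j; rewrite !inE => /andP[i1 _] /andP[_ js] ij.
  by rewrite ler_pM2r ?invr_gt0// ler_pM2l// ha_mono.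
split.
  move=> d T Omega omega p _ _ pP P _.
  apply: le_trans (stepup_kFWER_le (P := P) (p := p) (I := true_nulls omega P)
    (c_mono _ D1_gt0) _ k_gt0 _) _.
  - move=> j /andP[j1 js].
    rewrite divr_ge0 ?mulr_ge0 ?(ltW alpha_gt0) ?(ltW D1_gt0) ?a_ge0 ?j1//=.
    rewrite ltr_pdivrMr// mul1r (lt_le_trans _ D1_ge)//.
    rewrite (le_lt_trans (y := alpha * a s)) ?ler_pM2l ?ha_mono//.
    by rewrite gtr_pMl.
  - by move=> i; rewrite inE => /asboolP; exact: pP.
  rewrite lee_fin; set n := #|_|.
  have [nk|kn] := ltnP n k; first by rewrite big_geq// mulr0 ltW.
  have ns : (n <= s)%N by rewrite -[leqRHS]card_ord max_card.
  rewrite (eq_bigr (fun j =>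
    alpha / D1 a k s * (tail_weight R n j * a (s - n + j)%N))); last first.
    by move=> j _; ring.
  rewrite -mulr_sumr mulrCA -S1E ?k_gt0// -mulrA ger_pMr//.
  by rewrite mulrC ler_pdivrMr// mul1r S1_le_D1// kn.
move=> D' D'_gt0 control i i1s.
have D1_le : D1 a k s <= D'.
  have S1_le n : (k <= n <= s)%N -> S1 a k s n <= D'.
    move=> /andP[kn ns]; rewrite leNgt; apply/negP => D'_lt.
    have S1_gt0 : 0 < S1 a k s n by exact: lt_trans D'_lt.
    (* Larger than D' if the mass alpha * S1 / D' exceeds 1; still below S1. *)
    pose D := Num.max D' (alpha * S1 a k s n).
    have D_gt0 : 0 < D by rewrite lt_max D'_gt0.
    pose b j := alpha * a (s - n + j)%N / D.
    have bs l := @rank_offset_bounds k n s l k_gt0 ns.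
    have massE : n%:R * \sum_(k <= j < n.+1) tail_weight R n j * b j
        = alpha * S1 a k s n / D.
      rewrite S1E ?k_gt0// mulrA mulr_sumr mulr_sumr mulr_suml.
      by apply: eq_bigr => j _; rewrite /b; ring.
    have [|||||J [Q [Q01 QJ]]] :=
      @worst_case R s k n b (fun i => alpha * a i / D') k_gt0 kn ns.
    - by move=> j l /bs ? /bs ? jl; apply: c_mono; rewrite ?inE// leq_add2l.
    - by rewrite divr_ge0 ?mulr_ge0 ?(ltW alpha_gt0) ?(ltW D_gt0) ?a_ge0// bs// leqnn.
    - exact: c_mono.
    - move=> j /bs js; rewrite /b ler_wpM2l ?mulr_ge0 ?(ltW alpha_gt0) ?a_ge0//.
      by rewrite lef_pV2 ?posrE// le_max lexx.
    - by rewrite massE ler_pdivrMr// mul1r le_max lexx orbT.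
    rewrite massE => /le_trans /(_ (control J Q Q01 QJ)).
    rewrite lee_fin -mulrA ger_pMr// ler_pdivrMr// mul1r leNgt gt_max D'_lt.
    by rewrite gtr_pMl// alpha_lt1.
  rewrite /D1 big_nat; apply: bigmax_le => [|n].
    by rewrite S1_le// leqnn.
  by rewrite ltnS; exact: S1_le.
by rewrite ler_wpM2l ?mulr_ge0 ?(ltW alpha_gt0) ?a_ge0// lef_pV2 ?posrE.
Qed.
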